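(* Let $\alpha\in(0,1)$, let $f$ be a $(\delta,L,K,\epsilon)$-regular function satisfying the null hypothesis $H_0$: $f$ is $\epsilon$-non-periodic with constant $K$. Assume the condition $a\ge4c_\alpha$ (for all sufficiently large $n$), and $b=b_n\to\infty$, $b=o(n/\log n)$. Then the test $\phi$ has asymptotic significance level $\alpha$: under $H_0$, $$\limsup_{n\to\infty}P(\phi(X_m)=1)\le\alpha .$$
   Context: $\mathbb{T}=[T_{\min},T_{\max}]$ is a compact interval; $T=\{t_1,\dots,t_n\}$ with $t_i$ i.i.d. uniform on $\mathbb{T}$; $SW_{m,\tau}f(t)=(f(t),f(t+\tau),\dots,f(t+m\tau))\in\mathbb{R}^{m+1}$ with $m,\tau$ fixed; $X_m=X_{m,\tau}=SW_{m,\tau}f(T)$, $M_{m,\tau}=SW_{m,\tau}f(\mathbb{T})$. Let $L_{m,\tau}(t)=\binom{n}{b}^{-1}\sum_{j} I(d_H(X_{m,\tau},X_{m,\tau,b}^{(j)})>t)$, the sum over all $\binom nb$ subsamples of $X_{m,\tau}$ of size $b$, $d_H$ the Hausdorff distance, and $c_\alpha=2(L_{m,\tau})^{-1}(\alpha)$ with $(L_{m,\tau})^{-1}(\alpha)=\inf\{t\ge0:L_{m,\tau}(t)\le\alpha\}$. $\mathcal{P}(A)$ is the $1$-dimensional persistence diagram (off-diagonal points (birth, death), field coefficients) of the sublevel-set filtration of the distance function to $A$. The rejection region is $R=\{(x,y)\in\mathcal{P}(X_m): x<c_\alpha\text{ and }y-x\ge2c_\alpha\}$, and $\phi(X_m)=1$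 (reject $H_0$) if $|\mathcal{P}(X_m)\cap R|\ge1$, $\phi(X_m)=0$ (accept $H_0$) if $|\mathcal{P}(X_m)\cap R|=0$. The alternative $H_1$ is that $f$ is $(\Xi,\epsilon)$-periodic. A differentiable $f:\mathbb{R}\to\mathbb{R}$ with bounded derivative is $\epsilon$-non-periodic with constant $K>0$ if for all $t_1,t_2\in\mathbb{R}$ with $|t_1-t_2|\ge K\epsilon$ one has $|f(t_1)-f(t_2)|\ge\epsilon$ or $|f'(t_1)-f'(t_2)|\ge\epsilon$. A function $f:\mathbb{R}\to\mathbb{R}$ is $(\delta,L,K,\epsilon)$-regular if: $f\in C^2$; for all $t\in\mathbb{R}$, $|f'(t)|\ge\delta$ or $|f''(t)|\ge\delta$; for all $t\in\mathbb{R}$, $|f'(t)|\le L$ and $|f''(t)|\le L$; and for all $t_1,t_2\in\mathbb{R}$ with $|t_1-t_2|\le K\epsilon$, $|f(t_1)-f(t_2)|\ge\delta|t_1-t_2|$ or $|f'(t_1)-f'(t_2)|\ge\delta|t_1-t_2|$. $a=\frac{\sqrt{m+1}}{2}\min\{\epsilon,C_{\delta,L}\}$, where $C_{\delta,L}>0$ is a constant depending only on $\delta,L$ such that for every $(\delta,L,K,\epsilon)$-regular function $f$ that is $\epsilon$-non-periodic with constant $K$ (and $\tau$ small enough) $\mathcal{P}(M_{m,\tau})\cap([0,a)\times\mathbb{R})=\emptyset$. *)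

(* Defs.v *)
From HB Require Import structures.
From mathcomp Require Import all_boot all_order all_algebra.
From mathcomp Require Import finmap.
From mathcomp Require Import all_classical all_reals all_analysis.
From mathcomp.multinomials Require Import freeg.

Set Implicit Arguments.
Unset Strict Implicit.
Unset Printing Implicit Defensive.

Import Order.TTheory GRing.Theory Num.Theory.
Import numFieldNormedType.Exports.

Local Open Scope ring_scope.
Local Open Scope classical_set_scope.

Section Metric.
Context {R : realType} {N : nat}.
Implicit Types (p q : 'rV[R]_N) (A B : set 'rV[R]_N).

(* The library norm on ['rV[R]_N] is the sup norm; distances here are
   Euclidean.  Both induce the same topology. *)
Definition eucl_dist p q : R :=
  Num.sqrt (\sum_(i < N) (p ord0 i - q ord0 i) ^+ 2).

Definition dist_to A p : R := inf [set eucl_dist p q | q in A].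

Definition hausdorff_dist A B : R :=
  Num.max (sup [set dist_to B p | p in A]) (sup [set dist_to A p | p in B]).

Definition sublevel A (r : R) : set 'rV[R]_N := [set p | dist_to A p <= r].

End Metric.

Section SingularHomology.
Context {R : realType} (F : fieldType) {N : nat}.

Definition std_simplex (n : nat) : set 'rV[R]_n.+1 :=
  [set x | (forall i, 0 <= x ord0 i) /\ \sum_(i < n.+1) x ord0 i = 1].

Definition face_map (n : nat) (i : 'I_n.+2) (x : 'rV[R]_n.+1) : 'rV[R]_n.+2 :=
  \row_(j < n.+2) if unlift i j is Some k then x ord0 k else 0.

(* A singular simplex is coded by a total function that vanishes off the
   standard simplex, so that equality of codes is equality on the simplex. *)
Definition singular_simplex (n : nat) (U : set 'rV[R]_N)
    (s : 'rV[R]_n.+1 -> 'rV[R]_N) : Prop :=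
  [/\ {within @std_simplex n, continuous s},
      (forall x, std_simplex x -> U (s x)) &
      (forall x, ~ std_simplex x -> s x = 0)].

Definition simplex_face (n : nat) (i : 'I_n.+2) (s : 'rV[R]_n.+2 -> 'rV[R]_N) :
    'rV[R]_n.+1 -> 'rV[R]_N :=
  patch (fun=> 0) (@std_simplex n) (s \o face_map i).

Definition chain (n : nat) : Type := {freeg ('rV[R]_n.+1 -> 'rV[R]_N) / F}.

Definition singular_chain (n : nat) (U : set 'rV[R]_N) : set (chain n) :=
  [set c | forall s, s \in dom c -> singular_simplex U s].

Definition boundary (n : nat) : chain n.+1 -> chain n :=
  fglift (fun s => \sum_(i < n.+2) << (-1) ^+ i *g simplex_face i s >>).

Definition cycles1 (U : set 'rV[R]_N) : set (chain 1) :=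
  [set z | singular_chain U z /\ boundary z = 0].

Definition boundaries1 (U : set 'rV[R]_N) : set (chain 1) :=
  [set boundary c | c in @singular_chain 2 U].

(* H_1(U) = cycles1 U / boundaries1 U.  For U <= V, the image of H_1(U) ->
   H_1(V) is given by its preimage in [cycles1 V], and the kernel by its
   preimage in [cycles1 U]. *)

Definition im_H1 (U V : set 'rV[R]_N) : set (chain 1) :=
  [set z | exists z1 z2, [/\ cycles1 U z1, boundaries1 V z2 & z = z1 + z2]].

Definition ker_H1 (U V : set 'rV[R]_N) : set (chain 1) :=
  cycles1 U `&` boundaries1 V.

(* dim (W / W') in {0, 1, ..., +oo} for subspaces W' <= W of chains *)
Definition codim (W W' : set (chain 1)) : \bar R :=
  ereal_sup [set (k%:R)%:E | k in [set k : nat | exists z : 'I_k -> chain 1,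
    (forall i, W (z i)) /\
    (forall l : 'I_k -> F, W' (\sum_(i < k) l i *: z i) ->
       forall i, l i = 0)]].

End SingularHomology.

Section PersistenceDiagram.
Context {R : realType} (F : fieldType) {N : nat}.
Variable A : set 'rV[R]_N.

(* Number of points of the diagram in the rectangle [a, b] x [c, d], a < b < c
   < d: with V_s = H_1(sublevel A s), the multiplicity of the interval [b, c]
   in V_a -> V_b -> V_c -> V_d, that is the dimension of
   (im(V_b -> V_c) /\ ker(V_c -> V_d)) / (im(V_a -> V_c) /\ ker(V_c -> V_d))
   (Chazal, de Silva, Glisse, Oudot, The structure and stability of
   persistence modules). When ranks are finite it is the alternating sum
   beta(b,c) - beta(a,c) - beta(b,d) + beta(a,d) of persistent Betti numbers. *)
Definition rect_measure (a b c d : R) : \bar R :=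
  let V := sublevel A in
  codim (im_H1 (F := F) (V b) (V c) `&` ker_H1 (V c) (V d))
        (im_H1 (V a) (V c) `&` ker_H1 (V c) (V d)).

(* Multiplicity of (birth, death) = (p.1, p.2) in the 1-dimensional diagram:
   the measure of arbitrarily small rectangles around it.  The diagram is
   restricted to p.1 < p.2.  There is no point with infinite death, since
   large sublevel sets of the distance to a nonempty bounded set are
   star-shaped. *)
Definition dgm_mult (p : R * R) : \bar R :=
  if p.1 < p.2 then
    ereal_inf [set m | exists a b c d : R,
      [/\ a < p.1 < b, b < c, c < p.2 < d & m = rect_measure a b c d]]
  else 0%E.

Definition dgm : set (R * R) := [set p | (0 < dgm_mult p)%E].

(* |P(A) `&` D|, points being counted with multiplicity *)
Definition dgm_card (D : set (R * R)) : \bar R := (\esum_(p in D) dgm_mult p)%E.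

End PersistenceDiagram.

Section SlidingWindow.
Context {R : realType}.

Definition SW (m : nat) (tau : R) (f : R -> R) (t : R) : 'rV[R]_m.+1 :=
  \row_(k < m.+1) f (t + k%:R * tau).

Definition nonperiodic (eps K : R) (f : R -> R) : Prop :=
  [/\ (forall t, derivable f t 1),
      (exists M : R, forall t, `|derive1 f t| <= M) &
      (forall t1 t2, K * eps <= `|t1 - t2| ->
         eps <= `|f t1 - f t2| \/ eps <= `|derive1 f t1 - derive1 f t2|)].

Definition C2 (f : R -> R) : Prop :=
  [/\ (forall t, derivable f t 1), (forall t, derivable (derive1 f) t 1) &
      continuous (derive1n 2 f)].

Definition regular (delta L K eps : R) (f : R -> R) : Prop :=
  [/\ C2 f,
      (forall t, delta <= `|derive1 f t| \/ delta <= `|derive1n 2 f t|),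
      (forall t, `|derive1 f t| <= L /\ `|derive1n 2 f t| <= L) &
      (forall t1 t2, `|t1 - t2| <= K * eps ->
         delta * `|t1 - t2| <= `|f t1 - f t2| \/
         delta * `|t1 - t2| <= `|derive1 f t1 - derive1 f t2|)].

(* The bound a on births; [C] stands for the value of C_{delta,L}. *)
Definition birth_bound (m : nat) (eps C : R) : R :=
  Num.sqrt m.+1%:R / 2 * Num.min eps C.

(* The property that defines the constant C_{delta,L}, for the window (m, tau)
   and the interval [Tmin, Tmax]; that tau is small enough means that it
   holds. *)
Definition birth_constant (F : fieldType) (delta L K eps Tmin Tmax : R)
    (m : nat) (tau C : R) : Prop :=
  0 < C /\
  forall g : R -> R, regular delta L K eps g -> nonperiodic eps K g ->
    dgm F [set SW m tau g t | t in `[Tmin, Tmax]] `&`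
      [set p | 0 <= p.1 < birth_bound m eps C] = set0.

End SlidingWindow.

Section Test.
Context {R : realType} {N n : nat}.
Implicit Types x : 'I_n -> 'rV[R]_N.

(* The subsamples of size b are indexed by the b-subsets of the indices. *)
Definition subsample_tail (b : nat) x (t : R) : R :=
  ('C(n, b)%:R)^-1 *
  \sum_(S : {set 'I_n} | #|S| == b)
     (t < hausdorff_dist (range x) [set x i | i in [set i | i \in S]])%R%:R.

Definition subsample_quantile (b : nat) x (alpha : R) : R :=
  inf [set t | 0 <= t /\ subsample_tail b x t <= alpha].

Definition critical_value (b : nat) (alpha : R) x : R :=
  2 * subsample_quantile b x alpha.

Definition rejection_zone (c : R) : set (R * R) :=
  [set p | p.1 < c /\ 2 * c <= p.2 - p.1].

Definition phi (F : fieldType) (b : nat) (alpha : R) x : nat :=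
  (1 <= dgm_card F (range x) (rejection_zone (critical_value b alpha x)))%E.

End Test.

Section Sampling.
Context {R : realType} {d : measure_display} {Omega : measurableType d}.
Variable P : probability Omega R.

Definition mutually_independent (X : nat -> {RV P >-> R}) : Prop :=
  forall (J : {fset nat}) (B : nat -> set R),
    (forall i, measurable (B i)) ->
    P (\bigcap_(i in [set` J]) (X i @^-1` B i)) =
    (\prod_(i <- J) P (X i @^-1` B i))%E.

Definition iid_uniform (Tmin Tmax : R) (hT : Tmin < Tmax)
    (X : nat -> {RV P >-> R}) : Prop :=
  mutually_independent X /\
  forall i B, measurable B -> distribution P (X i) B = uniform_prob hT B.

(* X_{m,tau} for the first n sampling times *)
Definition SW_sample (m : nat) (tau : R) (f : R -> R)
    (X : nat -> {RV P >-> R}) (n : nat) (w : Omega) : 'I_n -> 'rV[R]_m.+1 :=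
  fun i => SW m tau f (X i w).

End Sampling.

Arguments SW_sample {R d Omega P} m tau f X n w _.

(* Main.v *)
Require Import Defs.
From HB Require Import structures.
From mathcomp Require Import all_boot all_order all_algebra.
From mathcomp Require Import finmap ring lra.
From mathcomp Require Import all_classical all_reals all_analysis.
From mathcomp Require Import measurable_realfun.
From mathcomp.multinomials Require Import freeg.

Import Order.TTheory GRing.Theory Num.Theory.
Import numFieldNormedType.Exports.

Local Open Scope ring_scope.
Local Open Scope classical_set_scope.

Set Implicit Arguments.
Unset Strict Implicit.
Unset Printing Implicit Defensive.

(* The rejection probability even tends to 0.  Since f is Lipschitz and
   nonconstant, M = SW f([Tmin, Tmax]) is a curve with two-sided control of its
   covering numbers.  On the one hand b points cannot be dense at scale 1/b: if
   f([Tmin, Tmax]) contains an interval of length r, then by pigeonhole on the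
   first coordinate every subsample of size b stays at Hausdorff distance at
   least r/(2b) from M.  On the other hand, if each of k = A b cells of equal
   length of [Tmin, Tmax] contains a sampling time, then the whole sample X is
   within h = O(1/k) of M; this fails with probability at most
   k (1 - 1/k)^n <= k exp(-n/k), which tends to 0 because b = o(n / log n).  For
   A large this gives d_H(X, subsample) > 2h for all subsamples, hence
   c_alpha >= 4h.  A diagram point of X in the rejection region then yields, by
   stability, a diagram point of M with birth at most 2 c_alpha, less than the
   birth bound a, which contradicts the choice of C_{delta,L}.

   Stability is only needed in a qualitative form: a rectangle has positive
   measure iff some cycle z of V_b bounds in V_d without being homologous in V_c
   to a cycle of V_a.  This property is transferred between interleaved
   filtrations, passes to one of the halves of a split rectangle, and hence
   localizes at a diagram point, without any finiteness of the ranks. *)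

(** * Euclidean distance and distance to a set *)

Section EuclideanDistance.
Context {R : realType} {N : nat}.
Implicit Types (p q r : 'rV[R]_N) (A B : set 'rV[R]_N).

Lemma sum_sqr_ge0 (a : 'I_N -> R) : 0 <= \sum_i a i ^+ 2.
Proof. by apply: sumr_ge0 => i _; exact: sqr_ge0. Qed.

(** Expanding the nonnegative sum of the squares of [v * a i - u * b i], with [u] and [v] the two
    norms, gives [2 * (u * v)] times the claim; vanishing norms are handled apart. *)
Lemma sum_cauchy_schwarz (a b : 'I_N -> R) :
  \sum_i a i * b i <= Num.sqrt (\sum_i a i ^+ 2) * Num.sqrt (\sum_i b i ^+ 2).
Proof.
set u := Num.sqrt _; set v := Num.sqrt _.
have u2 : u ^+ 2 = \sum_i a i ^+ 2 by rewrite sqr_sqrtr// sum_sqr_ge0.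
have v2 : v ^+ 2 = \sum_i b i ^+ 2 by rewrite sqr_sqrtr// sum_sqr_ge0.
have zero (c e : 'I_N -> R) : \sum_i c i ^+ 2 = 0 -> \sum_i c i * e i = 0.
  move=> /eqP; rewrite psumr_eq0; last by move=> i _; exact: sqr_ge0.
  move=> /allP c0; rewrite big1// => i _.
  by have := c0 i (mem_index_enum i); rewrite /= sqrf_eq0 => /eqP ->; rewrite mul0r.
have [u0|u0] := eqVneq u 0.
  by rewrite u0 mul0r zero// -u2 u0 expr0n.
have [v0|v0] := eqVneq v 0.
  under eq_bigr do rewrite mulrC.
  by rewrite v0 mulr0 zero// -v2 v0 expr0n.
have uv : 0 < u * v by rewrite mulr_gt0// lt_def ?u0 ?v0 sqrtr_ge0.
rewrite -(ler_pM2l uv).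
have : 0 <= \sum_i (v * a i - u * b i) ^+ 2 by exact: sum_sqr_ge0.
have -> : \sum_i (v * a i - u * b i) ^+ 2 =
    v ^+ 2 * (\sum_i a i ^+ 2) + u ^+ 2 * (\sum_i b i ^+ 2)
    - 2 * (u * v) * \sum_i a i * b i.
  by rewrite !mulr_sumr -big_split -sumrB /=; apply: eq_bigr => i _; ring.
by rewrite -u2 -v2; nra.
Qed.

Lemma eucl_dist_ge0 p q : 0 <= eucl_dist p q.
Proof. exact: sqrtr_ge0. Qed.

Lemma eucl_distxx p : eucl_dist p p = 0.
Proof.
by rewrite /eucl_dist big1 ?sqrtr0// => i _; rewrite subrr expr0n.
Qed.

Lemma eucl_dist_triangle p q r : eucl_dist p r <= eucl_dist p q + eucl_dist q r.
Proof.
have := sum_cauchy_schwarz (fun i => p ord0 i - q ord0 i)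
                           (fun i => q ord0 i - r ord0 i).
rewrite -/(eucl_dist p q) -/(eucl_dist q r) => CS.
rewrite -(@ler_sqr _ (eucl_dist p r)) ?nnegrE ?addr_ge0 ?eucl_dist_ge0//.
rewrite sqrrD !sqr_sqrtr ?sum_sqr_ge0//.
have -> : \sum_i (p ord0 i - r ord0 i) ^+ 2 =
    \sum_i (p ord0 i - q ord0 i) ^+ 2 + \sum_i (q ord0 i - r ord0 i) ^+ 2
    + 2 * \sum_i (p ord0 i - q ord0 i) * (q ord0 i - r ord0 i).
  by rewrite !mulr_sumr -!big_split /=; apply: eq_bigr => i _; ring.
by rewrite mulr2n; lra.
Qed.

Lemma coord_le_eucl_dist p q i : `|p ord0 i - q ord0 i| <= eucl_dist p q.
Proof.
rewrite -sqrtr_sqr ler_wsqrtr// (bigD1 i)//= lerDl.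
by apply: sumr_ge0 => j _; exact: sqr_ge0.
Qed.

Lemma eucl_dist_le p q s : 0 <= s -> (forall i, `|p ord0 i - q ord0 i| <= s) ->
  eucl_dist p q <= Num.sqrt N%:R * s.
Proof.
move=> s0 pqs; rewrite -{1}(ger0_norm s0) -sqrtr_sqr -sqrtrM ?ler0n//.
have -> : N%:R * s ^+ 2 = \sum_(i < N) s ^+ 2.
  by rewrite sumr_const card_ord mulr_natl.
apply: ler_wsqrtr; apply: ler_sum => i _.
by rewrite -real_normK ?num_real// lerXn2r ?nnegrE.
Qed.

Lemma has_lbound_dist A p : has_lbound [set eucl_dist p q | q in A].
Proof. by exists 0 => _ [q _ <-]; exact: eucl_dist_ge0. Qed.

Lemma dist_to_ge0 A p : 0 <= dist_to A p.
Proof.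
have [[q Aq]|A0] := pselect (A !=set0).
  apply: lb_le_inf; first by exists (eucl_dist p q), q.
  by move=> _ [r _ <-]; exact: eucl_dist_ge0.
(* For empty [A] the infimum takes its default value 0. *)
have -> : A = set0 by apply/seteqP; split => // q Aq; apply: A0; exists q.
by rewrite /dist_to image_set0 inf0.
Qed.

Lemma dist_to_le A p q : A q -> dist_to A p <= eucl_dist p q.
Proof. by move=> Aq; apply: ge_inf; [exact: has_lbound_dist|exists q]. Qed.

(** Nonemptiness of [B] matters: the distance to the empty set is 0 by default, while [near] would
    hold vacuously. *)
Lemma dist_to_near A B h p : B !=set0 ->
  (forall q, B q -> exists2 r, A r & eucl_dist q r <= h) ->
  dist_to A p <= dist_to B p + h.
Proof.
move=> [q0 Bq0] near; rewrite -lerBlDr; apply: lb_le_inf.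
  by exists (eucl_dist p q0), q0.
move=> _ [q /near[r Ar qr] <-]; rewrite lerBlDr.
apply: le_trans (dist_to_le p Ar) (le_trans (eucl_dist_triangle p q r) _).
by rewrite lerD2l.
Qed.

Lemma sublevel_near A B h s : B !=set0 ->
  (forall q, B q -> exists2 r, A r & eucl_dist q r <= h) ->
  sublevel B s `<=` sublevel A (s + h).
Proof.
move=> B0 near p /= ps; apply: le_trans (dist_to_near _ B0 near) _.
by rewrite lerD2r.
Qed.

End EuclideanDistance.

(** * Linear algebra of singular cycles and boundaries *)

Section Chains.
Context {R : realType} {F : fieldType} {N : nat}.
Implicit Types (U V : set 'rV[R]_N) (k : F).

Lemma boundaryB n (c1 c2 : @chain R F N n.+1) :
  boundary (c1 - c2) = boundary c1 - boundary c2.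
Proof. exact: lift_is_additive. Qed.

Lemma boundary0 n : boundary (0 : @chain R F N n.+1) = 0.
Proof. by have := boundaryB (0 : @chain R F N n.+1) 0; rewrite !subrr. Qed.

Lemma boundaryD n (c1 c2 : @chain R F N n.+1) :
  boundary (c1 + c2) = boundary c1 + boundary c2.
Proof.
have bN c : boundary (- c : @chain R F N n.+1) = - boundary c.
  by rewrite -[- c]sub0r boundaryB boundary0 sub0r.
by rewrite -[c2]opprK boundaryB [in RHS]bN.
Qed.

Lemma boundaryZ n k (c : @chain R F N n.+1) :
  boundary (k *: c) = k *: boundary c.
Proof.
(* Additivity passes to finite sums, so scaling is checked simplex by simplex. *)
have bsum (s : seq ('rV[R]_n.+2 -> 'rV[R]_N)) (G : _ -> @chain R F N n.+1) :
    boundary (\sum_(x <- s) G x) = \sum_(x <- s) boundary (G x).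
  elim: s => [|x s IH]; first by rewrite !big_nil boundary0.
  by rewrite !big_cons boundaryD IH.
rewrite -{2}[c]freeg_sumE {1}/GRing.scale /= /fgscale !bsum scaler_sumr.
by apply: eq_bigr => x _; rewrite /boundary !liftU scalerA.
Qed.

Lemma singular_chainS n U V :
  U `<=` V -> @singular_chain R F N n U `<=` singular_chain V.
Proof.
move=> UV c Uc s sc; have [cs Us s0] := Uc s sc.
by split => // x /Us; exact: UV.
Qed.

Lemma singular_chain0 n U : @singular_chain R F N n U 0.
Proof. by move=> s; rewrite dom0. Qed.

Lemma singular_chainB n U (c1 c2 : @chain R F N n) :
  singular_chain U c1 -> singular_chain U c2 -> singular_chain U (c1 - c2).
Proof.
by move=> U1 U2 s /domB; rewrite mem_cat => /orP[/U1|/U2].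
Qed.

Lemma singular_chainZ n U k (c : @chain R F N n) :
  singular_chain U c -> singular_chain U (k *: c).
Proof. by move=> Uc s /domZ_subset /Uc. Qed.

Lemma cycles1S U V : U `<=` V -> @cycles1 R F N U `<=` cycles1 V.
Proof. by move=> UV z [Uz bz]; split => //; exact: singular_chainS Uz. Qed.

Lemma cycles10 U : @cycles1 R F N U 0.
Proof. by split; [exact: singular_chain0|exact: boundary0]. Qed.

Lemma cycles1B U (z1 z2 : @chain R F N 1) :
  cycles1 U z1 -> cycles1 U z2 -> cycles1 U (z1 - z2).
Proof.
move=> [U1 b1] [U2 b2]; split; first exact: singular_chainB.
by rewrite boundaryB b1 b2 subrr.
Qed.

Lemma cycles1Z U k (z : @chain R F N 1) : cycles1 U z -> cycles1 U (k *: z).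
Proof.
by move=> [Uz bz]; split; [exact: singular_chainZ|rewrite boundaryZ bz scaler0].
Qed.

Lemma boundaries1S U V : U `<=` V -> @boundaries1 R F N U `<=` boundaries1 V.
Proof. by move=> UV z [c Uc <-]; exists c => //; exact: singular_chainS Uc. Qed.

Lemma boundaries10 U : @boundaries1 R F N U 0.
Proof. by exists 0; [exact: singular_chain0|exact: boundary0]. Qed.

Lemma boundaries1B U (z1 z2 : @chain R F N 1) :
  boundaries1 U z1 -> boundaries1 U z2 -> boundaries1 U (z1 - z2).
Proof.
move=> [c1 U1 <-] [c2 U2 <-]; exists (c1 - c2); first exact: singular_chainB.
exact: boundaryB.
Qed.

Lemma boundaries1Z U k (z : @chain R F N 1) :
  boundaries1 U z -> boundaries1 U (k *: z).
Proof.
move=> [c Uc <-]; exists (k *: c); first exact: singular_chainZ.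
exact: boundaryZ.
Qed.

Lemma im_H1S U U' V V' : U `<=` U' -> V `<=` V' ->
  @im_H1 R F N U V `<=` im_H1 U' V'.
Proof.
move=> UU VV z [z1 [z2 [Uz1 Vz2 ->]]]; exists z1, z2.
by split => //; [exact: cycles1S Uz1|exact: boundaries1S Vz2].
Qed.

Lemma im_H1Z U V k (z : @chain R F N 1) : im_H1 U V z -> im_H1 U V (k *: z).
Proof.
move=> [z1 [z2 [Uz1 Vz2 ->]]]; exists (k *: z1), (k *: z2).
by split; [exact: cycles1Z|exact: boundaries1Z|exact: scalerDr].
Qed.

Lemma cycles1_im U V : @cycles1 R F N U `<=` im_H1 U V.
Proof.
move=> z Uz; exists z, 0; split => //; first exact: boundaries10.
by rewrite addr0.
Qed.

Lemma cycles1_set0 (z : @chain R F N 1) : cycles1 set0 z -> z = 0.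
Proof.
move=> [Uz _]; apply/eqP; rewrite -dom_eq0.
case E : (dom z) => [//|s l].
have [|_ + _] := Uz s; first by rewrite E inE eqxx.
(* A simplex in the support of [z] would send this vertex of the standard 1-simplex into the empty
   set. *)
move=> /(_ (\row_(i < 2) (i == 0)%:R)) []; split.
  by move=> i; rewrite mxE ler0n.
rewrite big_ord_recl big1 ?mxE ?addr0//.
by move=> i _; rewrite mxE.
Qed.

(** A nonempty family that is free modulo [W'] has its first member outside [W']: otherwise the
    coefficients 1, 0, ..., 0 contradict freeness. *)
Lemma codim_gt0 (W W' : set (@chain R F N 1)) :
  (0 < codim W W')%E -> exists2 z, W z & ~ W' z.
Proof.
move=> /ereal_sup_gt[_ [k [z [Wz zfree]] <-]].
case: k z Wz zfree => [z _ _|k z Wz zfree]; first by rewrite ltxx.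
move=> _; exists (z ord0) => // W'z0.
have W'l : W' (\sum_(i < k.+1) (i == ord0)%:R *: z i).
  rewrite big_ord_recl big1 ?addr0 ?scale1r//.
  by move=> i _; rewrite scale0r.
by have /eqP := zfree (fun i => (i == ord0)%:R) W'l ord0; rewrite oner_eq0.
Qed.

(** The family made of [z] alone is free modulo [W'], since a nonzero coefficient could be divided
    out. *)
Lemma gt0_codim (W W' : set (@chain R F N 1)) z :
  (forall k z, W' z -> W' (k *: z)) -> W z -> ~ W' z -> (0 < codim W W')%E.
Proof.
move=> W'Z Wz nW'z.
apply: (@lt_le_trans _ _ (1%:R)%:E); first by rewrite lte_fin.
apply: ereal_sup_ubound; exists 1%N => //; exists (fun=> z); split => // l.
rewrite big_ord_recl big_ord0 addr0 => W'lz i; rewrite ord1.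
apply/eqP/negPn/negP => l0; apply: nW'z.
by rewrite -[z]scale1r -(mulVf l0) -scalerA; exact: W'Z.
Qed.

End Chains.

(** * Charged rectangles and qualitative stability of the diagram *)

Section RectangleMeasure.
Context {R : realType} (F : fieldType) {N : nat}.
Implicit Types (A B : set 'rV[R]_N) (a b c d : R).

Lemma sublevelS A a b : a <= b -> sublevel A a `<=` sublevel A b.
Proof. by move=> ab p /= /le_trans; exact. Qed.

Definition charged A a b c d : Prop :=
  exists z : @chain R F N 1, [/\ cycles1 (sublevel A b) z,
    boundaries1 (sublevel A d) z &
    ~ im_H1 (sublevel A a) (sublevel A c) z].

(** An element of the image is [z1 + z2] with [z1] a cycle at level [b] and [z2] a boundary at level
    [c]. Dropping [z2] affects neither bounding at level [d] nor, modulo boundaries at level [c],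
    coming from level [a]. *)
Lemma rect_measure_gt0 A a b c d : b <= c -> c <= d ->
  (0 < rect_measure F A a b c d)%E <-> charged A a b c d.
Proof.
move=> bc cd; split.
  move=> /codim_gt0[_ [[z1 [z2 [z1b z2c ->]]] [zc zd]] nz].
  have z1d : boundaries1 (sublevel A d) z1.
    rewrite -[z1](addrK z2); apply: boundaries1B => //.
    by apply: boundaries1S z2c; exact: sublevelS.
  exists z1; split => // -[y1 [y2 [y1a y2c z1E]]]; apply: nz; split => //.
  exists y1, (y2 + z2); split => //; last by rewrite z1E addrA.
  rewrite -[z2]opprK; apply: boundaries1B => //.
  by rewrite -sub0r; apply: boundaries1B => //; exact: boundaries10.
move=> [z [zb zd nz]]; apply: (@gt0_codim _ _ _ _ _ z) => [k y [yi [yc yd]]||[]//].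
  split; first exact: im_H1Z.
  by split; [exact: cycles1Z|exact: boundaries1Z].
split; first exact: cycles1_im.
by split => //; apply: cycles1S zb; exact: sublevelS.
Qed.

(** The same cycle serves: larger sets at [b] and [d] keep it alive and bounding, smaller sets at
    [a] and [c] make it harder to come from [a]. *)
Lemma charged_shift A B a b c d a' b' c' d' :
  sublevel A b `<=` sublevel B b' -> sublevel A d `<=` sublevel B d' ->
  sublevel B a' `<=` sublevel A a -> sublevel B c' `<=` sublevel A c ->
  charged A a b c d -> charged B a' b' c' d'.
Proof.
move=> bb dd aa cc [z [zb zd nz]]; exists z; split.
- exact: cycles1S zb.
- exact: boundaries1S zd.
- by move=> iz; apply: nz; exact: im_H1S iz.
Qed.

Lemma chargedS A a b c d a' b' c' d' : a' <= a -> b <= b' -> c' <= c ->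
  d <= d' -> charged A a b c d -> charged A a' b' c' d'.
Proof. by move=> aa bb cc dd; apply: charged_shift; exact: sublevelS. Qed.

(** If [z] is homologous at level [c] to a cycle [z1] of level [e], then [z1] charges the left half;
    otherwise [z] itself charges the right half. *)
Lemma charged_birth_split A a b c d e : c <= d ->
  charged A a b c d -> charged A a e c d \/ charged A e b c d.
Proof.
move=> cd [z [zb zd nz]].
have [[z1 [z2 [z1e z2c zE]]]|nze] := pselect (im_H1 (sublevel A e) (sublevel A c) z).
  left; exists z1; split => //.
    rewrite -[z1](addrK z2) -zE; apply: boundaries1B => //.
    by apply: boundaries1S z2c; exact: sublevelS.
  move=> [y1 [y2 [y1a y2c z1E]]]; apply: nz; exists y1, (y2 + z2).
  split => //; last by rewrite zE z1E addrA.
  rewrite -[z2]opprK; apply: boundaries1B => //.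
  by rewrite -sub0r; apply: boundaries1B => //; exact: boundaries10.
by right; exists z.
Qed.

(** If [z = z1 + z2] with [z1] a cycle at level [a] and [z2] a boundary at level [e], then [z2]
    charges the lower half; otherwise [z] itself charges the upper half. *)
Lemma charged_death_split A a b c d e : a <= b ->
  charged A a b c d -> charged A a b c e \/ charged A a b e d.
Proof.
move=> ab [z [zb zd nz]].
have [[z1 [z2 [z1a z2e zE]]]|nze] := pselect (im_H1 (sublevel A a) (sublevel A e) z).
  left; exists z2; split => //.
    rewrite -[z2](addKr z1) -zE addrC; apply: cycles1B => //.
    by apply: cycles1S z1a; exact: sublevelS.
  move=> [y1 [y2 [y1a y2c z2E]]]; apply: nz; exists (z1 + y1), y2.
  split => //; last by rewrite zE z2E addrA.
  rewrite -[y1]opprK; apply: cycles1B => //.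
  by rewrite -sub0r; apply: cycles1B => //; exact: cycles10.
by right; exists z.
Qed.

(** Sublevel sets at negative levels are empty and carry only the zero cycle, which comes from every
    level. *)
Lemma charged_birth_ge0 A a b c d : charged A a b c d -> 0 <= b.
Proof.
move=> [z [zb _ nz]]; rewrite leNgt; apply/negP => b0; apply: nz.
have A0 : sublevel A b = set0.
  apply/seteqP; split => // p /= pb.
  by have := le_trans (dist_to_ge0 A p) pb; rewrite leNgt b0.
move: zb; rewrite A0 => /cycles1_set0->.
by apply: cycles1_im; exact: cycles10.
Qed.

(* The supremum of the [t] with [~ Q a t] does the job of a bisection. *)
Lemma split_interval_point (Q : R -> R -> Prop) a b : a <= b ->
  (forall u v u' v', u' <= u -> v <= v' -> Q u v -> Q u' v') ->
  (forall u e v, u < e < v -> Q u v -> Q u e \/ Q e v) ->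
  Q a b -> exists2 x, a <= x <= b & forall u v, u < x < v -> Q u v.
Proof.
move=> ab QS Qsplit Qab.
(* The point [a] is added to make [S] nonempty whatever [Q a a] is. *)
pose S := [set t | a <= t <= b /\ (t = a \/ ~ Q a t)].
have Sa : S a by split; [rewrite lexx|left].
have bS : has_ubound S by exists b => t [/andP[]].
have Sx t : S t -> t <= sup S by move=> St; exact: ub_le_sup.
have xb : sup S <= b by apply: ge_sup; [exists a|move=> t [/andP[]]].
exists (sup S); first by rewrite Sx.
move=> u v /andP[ux xv].
have Qav : Q a (Num.min v b).
  rewrite /Num.min; case: ifPn => [vb|_]; last exact: Qab.
  apply: contrapT => nQ; suff /Sx : S v by rewrite leNgt xv.
  by split; [rewrite (ltW vb) andbT (le_trans (Sx _ Sa)) ?ltW|right].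
have wv : Num.min v b <= v by rewrite ge_min lexx.
have [ua|au] := leP u a; first exact: QS Qav.
have [t [tab tQ] ut] := sup_gt (ex_intro _ a Sa) ux.
have nQat : ~ Q a t.
  by case: tQ => // ta; move: ut; rewrite ta ltNge (ltW au).
(* [Q a u] is impossible, as it would extend to [Q a t]; the other half gives [Q u v]. *)
have [|Qau|/(QS _ _ u v)] := Qsplit a u (Num.min v b) _ Qav; last exact.
  by rewrite au lt_min (lt_trans ux xv) (lt_le_trans ux xb).
by exfalso; apply: nQat; apply: QS Qau => //; exact: ltW.
Qed.

Lemma charged_point A a b c d : a <= b -> b < c -> c <= d ->
  charged A a b c d -> exists x y, [/\ a <= x <= b, c <= y <= d &
    forall u v s t, u < x < v -> s < y < t -> charged A u v s t].
Proof.
move=> ab bc cd Qabcd.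
have [x xab Qx] : exists2 x, a <= x <= b &
    forall u v, u < x < v -> charged A u v c d.
  apply: (split_interval_point (Q := fun u v => charged A u v c d)) Qabcd => //
    [u v u' v' uu vv|u e v _].
    exact: chargedS.
  exact: charged_birth_split.
(* Quantifying over all birth intervals around [x] keeps the birth localized while the death is
   being localized. *)
pose Q s t := forall u v, u < x < v -> charged A u v s t.
have [y ycd Qy] : exists2 y, c <= y <= d & forall s t, s < y < t -> Q s t.
  apply: (split_interval_point (Q := Q)) Qx => // [s t s' t' ss tt Qst u v uxv|].
    by apply: (chargedS _ _ ss tt (Qst u v uxv)).
  move=> s e t _ Qst.
  have [|/existsNP[u1 /existsNP[v1 /not_implyP[/andP[u1x xv1] n1]]]] :=
    pselect (Q s e); first by left.
  right => u v /andP[ux xv].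
  (* The intersection of both birth intervals is charged on [s, t]. Its lower death half would
     charge [u1, v1] on [s, e], which is excluded, so the upper half is charged. *)
  have uxv : Num.max u u1 < x < Num.min v v1.
    by rewrite gt_max lt_min ux u1x xv xv1.
  have uv : Num.max u u1 <= Num.min v v1.
    by case/andP: uxv => + /(lt_trans _); move=> /[swap]/[apply]/ltW.
  have [Q1|Q2] := charged_death_split e uv (Qst _ _ uxv).
    by exfalso; apply: n1; apply: chargedS Q1;
      rewrite ?le_max ?ge_min ?lexx ?orbT.
  by apply: chargedS Q2; rewrite ?le_max ?ge_min ?lexx ?orbT.
by exists x, y; split => // u v s t uxv syt; exact: Qy syt _ _ uxv.
Qed.

Lemma dgm_charged A (x y a b c d : R) : dgm F A (x, y) ->
  a < x < b -> b < c -> c < y < d -> charged A a b c d.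
Proof.
rewrite /dgm /= /dgm_mult /=; case: ifPn => [xy|_]; last by rewrite ltxx.
move=> m0 axb bc cyd; apply/rect_measure_gt0; [exact: ltW| |].
  by case/andP: cyd => + /(lt_trans _); move=> /[swap]/[apply]/ltW.
by apply: lt_le_trans m0 _; apply: ereal_inf_lbound; exists a, b, c, d.
Qed.

(** A positive rectangle measure is a supremum of integers, hence at least 1, so the infimum over
    shrinking rectangles stays positive. *)
Lemma charged_dgm A (x y : R) : x < y ->
  (forall a b c d, a < x < b -> c < y < d -> charged A a b c d) ->
  dgm F A (x, y).
Proof.
move=> xy Axy; rewrite /dgm /= /dgm_mult /= xy.
apply: (@lt_le_trans _ _ 1%:E); first by rewrite lte_fin.
apply: le_ereal_inf_tmp => _ [a [b [c [d [axb bc cyd ->]]]]].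
have cd : c <= d by case/andP: cyd => + /(lt_trans _); move=> /[swap]/[apply]/ltW.
have /rect_measure_gt0 : charged A a b c d by exact: Axy.
rewrite /rect_measure => /(_ (ltW bc) cd).
move=> /ereal_sup_gt[_ [k Wk <-]]; rewrite lte_fin ltr0n => k0.
apply: le_trans (ereal_sup_ubound _); last by exists k.
by rewrite lee_fin ler1n.
Qed.

(** The square of half-side [e] around the point is charged for [A], so the one of half-side [e + h]
    is charged for [B] and contains a diagram point. The bound on [y - x] keeps this larger square
    off the diagonal. *)
Lemma dgm_stability A B h e (x y : R) :
  (forall s, sublevel A s `<=` sublevel B (s + h)) ->
  (forall s, sublevel B s `<=` sublevel A (s + h)) ->
  0 <= h -> 0 < e -> 2 * (h + e) < y - x -> dgm F A (x, y) ->
  exists p, [/\ dgm F B p, 0 <= p.1 & p.1 <= x + e + h].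
Proof.
move=> AB BA h0 e0 xye Axy.
have : charged B (x - e - h) (x + e + h) (y - e - h) (y + e + h).
  apply: (@charged_shift A _ (x - e) (x + e) (y - e) (y + e)) => //.
  - by rewrite -{2}[x - e](subrK h); exact: BA.
  - by rewrite -{2}[y - e](subrK h); exact: BA.
  - by apply: dgm_charged Axy _ _ _; lra.
move=> /charged_point[|||x' [y' [x'I y'I Bxy]]]; [lra|lra|lra|].
have xy' : x' < y' by lra.
have Bp : dgm F B (x', y') by apply: charged_dgm.
exists (x', y'); split => //=; last by lra.
rewrite leNgt; apply/negP => x0.
(* If [x'] is negative, [x' / 2] is a negative level to the right of [x']. *)
have /charged_birth_ge0 : charged B (x' - 1) (x' / 2) (y' - 1) (y' + 1).
  by apply: Bxy; lra.
by rewrite leNgt pmulr_llt0 ?invr_gt0// x0.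
Qed.

End RectangleMeasure.

(** * Subsample quantiles and the rejection criterion *)

Section Subsamples.
Context {R : realType} {N n : nat}.
Implicit Types (x : 'I_n -> 'rV[R]_N) (S : {set 'I_n}) (b : nat) (alpha : R).

Local Notation subsample x S := [set x i | i in [set i | i \in S]].

(** Strictness survives the infimum because a finite set attains it; for empty [S] the distance
    would be 0 by default. *)
Lemma lt_dist_to_subsample x S p t : S != finset.set0 ->
  (t < dist_to (subsample x S) p) <->
  (forall j, j \in S -> t < eucl_dist p (x j)).
Proof.
move=> /set0Pn[j1 j1S]; split => [tS j jS|tS].
  by apply: lt_le_trans tS _; apply: dist_to_le; exists j.
case: (@arg_minP _ _ _ j1 (fun j => j \in S) (fun j => eucl_dist p (x j)) j1S).
move=> j0 j0S j0min; apply: lt_le_trans (tS j0 j0S) _; apply: lb_le_inf.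
  by exists (eucl_dist p (x j1)), (x j1) => //; exists j1.
by move=> _ [_ [j jS <-] <-]; exact: j0min.
Qed.

(** A subsample lies in the sample, so the supremum over its points is at most 0 and only distances
    from sample points to the subsample count. *)
Lemma lt_hausdorff_subsample x S t : 0 <= t -> S != finset.set0 ->
  (t < hausdorff_dist (range x) (subsample x S)) <->
  (exists i, forall j, j \in S -> t < eucl_dist (x i) (x j)).
Proof.
move=> t0 S0; have [j1 j1S] := set0Pn _ S0; split.
  rewrite /hausdorff_dist lt_max => /orP[/sup_gt|].
    have /[swap]/[apply] : [set dist_to (subsample x S) p
        | p in range x] !=set0.
      by eexists; exists (x j1) => //; exists j1.
    by move=> [_ [_ [i _ <-] <-]] /(lt_dist_to_subsample _ _ _ S0) ?; exists i.
  rewrite ltNge; apply: contraNP => _; apply: le_trans t0; apply: ge_sup.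
    by eexists; exists (x j1) => //; exists j1.
  move=> _ [_ [j _ <-] <-]; rewrite -(eucl_distxx (x j)).
  by apply: dist_to_le; exists j.
move=> [i iS]; rewrite /hausdorff_dist lt_max; apply/orP; left.
set B := subsample x S.
apply: (@lt_le_trans _ _ (dist_to B (x i))).
  exact/lt_dist_to_subsample.
apply: ub_le_sup; last by exists (x i) => //; exists i.
exists (\sum_k dist_to B (x k)) => _ [_ [k _ <-] <-].
rewrite (bigD1 k)//= lerDl; apply: sumr_ge0 => k' _; exact: dist_to_ge0.
Qed.

Lemma subsample_tail_nincr b x s t : s <= t ->
  subsample_tail b x t <= subsample_tail b x s.
Proof.
move=> st; rewrite /subsample_tail ler_wpM2l ?invr_ge0//.
apply: ler_sum => S _; rewrite ler_nat.
by have [/(le_lt_trans st)->|] := ltP t.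
Qed.

Lemma subsample_tail_full b x t : (b <= n)%N ->
  (forall S, #|S| = b -> t < hausdorff_dist (range x) (subsample x S)) ->
  subsample_tail b x t = 1.
Proof.
move=> bn tS; rewrite /subsample_tail.
under eq_bigr => S /eqP /tS dSt do rewrite dSt.
rewrite sumr_const -cardsE card_draws card_ord.
by rewrite mulVf// pnatr_eq0 -lt0n bin_gt0.
Qed.

(** Makes the set in [subsample_quantile] nonempty for [0 <= alpha], so that its infimum is not a
    default value. *)
Lemma subsample_tail0 b x : exists2 t, 0 <= t & subsample_tail b x t = 0.
Proof.
pose dS S := hausdorff_dist (range x) (subsample x S).
exists (\sum_S `|dS S|); first exact: sumr_ge0.
rewrite /subsample_tail big1 ?mulr0// => S _; rewrite ltNge -/(dS S).
suff -> : dS S <= \sum_S `|dS S| by [].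
by rewrite (le_trans (ler_norm _))// (bigD1 S)//= lerDl sumr_ge0.
Qed.

Lemma subsample_quantile_le b x alpha s : 0 <= s -> subsample_tail b x s <= alpha ->
  subsample_quantile b x alpha <= s.
Proof. by move=> s0 sa; apply: ge_inf => //; exists 0 => t []. Qed.

Lemma subsample_quantile_ge b x alpha s : 0 <= alpha -> alpha < subsample_tail b x s ->
  s <= subsample_quantile b x alpha.
Proof.
move=> a0 sa; apply: lb_le_inf.
  by have [t t0 tE] := subsample_tail0 b x; exists t; rewrite /= tE.
move=> t [t0 ta]; rewrite leNgt; apply/negP => ts.
have := lt_le_trans sa (le_trans (subsample_tail_nincr b x (ltW ts)) ta).
by rewrite ltxx.
Qed.

End Subsamples.

(** A positive sum of multiplicities over the zone has a positive term. *)
Lemma phi_eq1 (R : realType) (F : fieldType) (N n b : nat) (alpha : R)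
    (x : 'I_n -> 'rV[R]_N) :
  phi F b alpha x = 1%N -> exists2 p, dgm F (range x) p &
    p.1 < critical_value b alpha x /\
    2 * critical_value b alpha x <= p.2 - p.1.
Proof.
rewrite /phi; case: (boolP (1 <= _)%E) => // D1 _.
have /ereal_sup_gt[_ [J [_ JD] <-] J0] :
    (0 < dgm_card F (range x) (rejection_zone (critical_value b alpha x)))%E.
  by apply: lt_le_trans D1; rewrite lte_fin.
apply: contrapT => nD; move: J0; rewrite ltNge => /negP; apply.
apply: fsume_le0 => p /JD [p1 p2]; rewrite leNgt; apply/negP => p0.
by apply: nD; exists p.
Qed.

(** * Geometry of the sliding window curve and cells of the time interval *)

Section Curve.
Context {R : realType}.
Implicit Types (f : R -> R) (L u l : R).

Lemma lipschitz_derive f L s t : (forall t, derivable f t 1) ->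
  (forall t, `|derive1 f t| <= L) -> `|f s - f t| <= L * `|s - t|.
Proof.
move=> df fL; wlog st : s t / s <= t.
  by move=> H; have [/H//|/ltW/H] := leP s t; rewrite distrC [ `|t - s| ]distrC.
have [||c _ E] := @MVT_segment _ f (derive1 f) s t st.
- by move=> x _; apply: DeriveDef => //; rewrite derive1E.
- apply: continuous_subspaceT => z.
  exact/differentiable_continuous/derivable1_diffP.
by rewrite distrC [ `|s - t| ]distrC E normrM ler_wpM2r.
Qed.

(** If [f] were constant on the interval, [f'] would vanish inside, and the last clause of
    regularity would fail for two close interior points. *)
Lemma regular_nonconstant delta L K eps f a b : 0 < delta -> 0 < K -> 0 < eps ->
  a < b -> regular delta L K eps f ->
  exists s t, [/\ a <= s <= b, a <= t <= b & f s < f t].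
Proof.
move=> d0 K0 e0 ab [[df _ _] _ _ reg]; apply: contrapT => nst.
have fc s t : a <= s <= b -> a <= t <= b -> f s = f t.
  move=> sI tI; have [st|ts|//] := ltgtP (f s) (f t); exfalso; apply: nst.
  - by exists s, t.
  - by exists t, s.
have f'0 t : a < t < b -> derive1 f t = 0.
  move=> tI; rewrite derive1E (@near_eq_derive _ _ _ _ (cst (f t))) ?derive_cst//.
  have : t \in `]a, b[%R by rewrite in_itv.
  move=> /near_in_itvoo; apply: filterS => s; rewrite in_itv/= => sI.
  by apply: fc; lra.
(* Small enough for that clause to apply and for [c + w] to stay inside the interval. *)
pose w := Num.min (K * eps) ((b - a) / 2) / 2.
have w0 : 0 < w by rewrite divr_gt0// lt_min mulr_gt0//= divr_gt0// subr_gt0.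
have wK : w <= K * eps /\ w <= (b - a) / 4.
  rewrite /w; have := ge_min (K * eps) (K * eps) ((b - a) / 2).
  have := ge_min ((b - a) / 2) (K * eps) ((b - a) / 2).
  by rewrite !lexx orbT /= => m1 m2; have := w0; rewrite /w; lra.
pose c := (a + b) / 2.
have := reg (c + w) c; rewrite addrAC subrr add0r (gtr0_norm w0) => /(_ wK.1).
have dw : 0 < delta * w by rewrite mulr_gt0.
by rewrite (fc (c + w) c) ?f'0 ?subrr ?normr0 /c; have := wK.2; lra.
Qed.

(* Among [b + 1] equally spaced points of the interval, two with the same
   nearest [y j] would be too close to one another. *)
Lemma far_point n (S : {set 'I_n}) (y : 'I_n -> R) u l : 0 < l -> (0 < #|S|)%N ->
  exists2 v, u <= v <= u + l & forall j, j \in S -> l / (2 * #|S|%:R) <= `|v - y j|.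
Proof.
move=> l0 S0; set b := #|S|; apply: contrapT => nv.
have b0 : (0 : R) < b%:R by rewrite ltr0n.
pose v (i : 'I_b.+1) := u + i%:R * (l / b%:R).
have vj i : exists j : 'I_n, (j \in S) && (`|v i - y j| < l / (2 * b%:R)).
  apply: contrapT => nj; apply: nv; exists (v i).
    have ib : i%:R <= b%:R :> R by rewrite ler_nat -ltnS.
    rewrite /v; apply/andP; split.
      by rewrite lerDl mulr_ge0// divr_ge0 ?ltW.
    by rewrite lerD2l mulrA ler_pdivrMr// mulrC ler_wpM2l// ltW.
  move=> j jS; rewrite leNgt; apply/negP => jv; apply: nj; exists j.
  by rewrite jS.
pose g i : {j | j \in S} := let: exist j H := cid (vj i) in
  exist _ j (proj1 (andP H)).
have gv i : `|v i - y (val (g i))| < l / (2 * b%:R).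
  by rewrite /g; case: cid => j /= /andP[].
have ginj : injective g.
  move=> i1 i2 gE; apply/val_inj/eqP; rewrite eqn_leq.
  have := gv i1; have := gv i2; rewrite gE /v.
  set z := y _; set q := l / b%:R.
  have -> : l / (2 * b%:R) = q / 2 by rewrite /q; field; rewrite gt_eqF.
  have q0 : 0 < q by rewrite divr_gt0.
  move=> h2 h1; apply/andP; split; rewrite leqNgt; apply/negP => ii.
    have : (i2 : nat)%:R + 1 <= (i1 : nat)%:R :> R by rewrite natr1 ler_nat.
    by move: h1 h2; rewrite !ltr_norml; nra.
  have : (i1 : nat)%:R + 1 <= (i2 : nat)%:R :> R by rewrite natr1 ler_nat.
  by move: h1 h2; rewrite !ltr_norml; nra.
have := leq_card g ginj; rewrite card_ord card_sig.
by rewrite (eq_card (_ : _ =i mem S)) ?ltnn// => j; rewrite !inE.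
Qed.

Lemma eucl_dist_SW m tau f L s t : 0 <= L -> (forall t, derivable f t 1) ->
  (forall t, `|derive1 f t| <= L) ->
  eucl_dist (SW m tau f s) (SW m tau f t) <= Num.sqrt m.+1%:R * (L * `|s - t|).
Proof.
move=> L0 df fL; apply: eucl_dist_le; first by rewrite mulr_ge0.
move=> i; rewrite !mxE.
apply: le_trans (lipschitz_derive (s + i%:R * tau) (t + i%:R * tau) df fL) _.
by rewrite opprD addrACA subrr addr0.
Qed.

Lemma dist_le_eucl_dist_SW m tau f s t :
  `|f s - f t| <= eucl_dist (SW m tau f s) (SW m tau f t).
Proof.
have := coord_le_eucl_dist (SW m tau f s) (SW m tau f t) ord0.
by rewrite !mxE mul0r !addr0.
Qed.

Definition cell (Tmin Tmax : R) (k c : nat) : set R :=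
  `[Tmin + c%:R * ((Tmax - Tmin) / k%:R),
    Tmin + c.+1%:R * ((Tmax - Tmin) / k%:R)].

Lemma mem_cell Tmin Tmax k t : (0 < k)%N -> Tmin <= t <= Tmax ->
  exists c : 'I_k, cell Tmin Tmax k c t.
Proof.
move=> k0 tI; set w := (Tmax - Tmin) / k%:R.
have kw : k%:R * w = Tmax - Tmin.
  by rewrite /w mulrC divfK// pnatr_eq0 -lt0n.
have ex : exists c, t <= Tmin + c.+1%:R * w.
  by exists k.-1; rewrite prednK// kw; lra.
have [c tc cmin] := ex_minnP ex.
have ck : (c < k)%N.
  by rewrite -(prednK k0) ltnS; apply: cmin; rewrite prednK// kw; lra.
exists (Ordinal ck); rewrite /cell /= in_itv /= -/w tc andbT.
case: c tc cmin ck => [|c] _ cmin _; first by rewrite mul0r addr0; case/andP: tI.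
by rewrite leNgt; apply/negP => /ltW/cmin; rewrite ltnn.
Qed.

Lemma cell_diam Tmin Tmax k c s t : cell Tmin Tmax k c s -> cell Tmin Tmax k c t ->
  `|s - t| <= (Tmax - Tmin) / k%:R.
Proof.
rewrite /cell /= !in_itv /= -natr1; set w := _ / k%:R.
rewrite mulrDl mul1r; set z := _ * w.
by move=> sI tI; rewrite ler_norml; lra.
Qed.

End Curve.

(** * Deterministic acceptance for dense samples *)

Section DenseSample.
Context {R : realType} (F : fieldType).

Lemma dense_sample_accepts (Tmin Tmax : R) (m : nat) (tau delta L K eps C : R)
    (alpha : R) (f : R -> R) (n b : nat) (u : 'I_n -> R) (w r v0 : R) :
  0 < L -> birth_constant F delta L K eps Tmin Tmax m tau C ->
  0 <= alpha < 1 -> regular delta L K eps f -> nonperiodic eps K f ->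
  0 < r -> (forall v, v0 <= v <= v0 + r -> exists2 t, Tmin <= t <= Tmax & f t = v) ->
  0 < w -> (0 < b <= n)%N -> 3 * (Num.sqrt m.+1%:R * (L * w)) < r / (2 * b%:R) ->
  (forall i, Tmin <= u i <= Tmax) ->
  (forall t, Tmin <= t <= Tmax -> exists i, `|t - u i| <= w) ->
  2 * critical_value b alpha (fun i => SW m tau f (u i)) < birth_bound m eps C ->
  phi F b alpha (fun i => SW m tau f (u i)) <> 1%N.
Proof.
move=> L0 [C0 hC] /andP[a0 a1] reg np r0 rf w0 /andP[b0 bn] wr uT udense.
set x := fun i => _; set c := critical_value _ _ _ => ca.
have [df fL] : (forall t, derivable f t 1) /\ (forall t, `|derive1 f t| <= L).
  by case: reg => -[df _ _] _ fL _; split => // t; have [] := fL t.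
set h := Num.sqrt m.+1%:R * (L * w) in wr.
have h0 : 0 < h by rewrite !mulr_gt0// sqrtr_gt0 ltr0n.
set M := [set SW m tau f t | t in `[Tmin, Tmax]].
have near q : M q -> exists2 p, range x p & eucl_dist q p <= h.
  move=> [t + <-]; rewrite /= in_itv /= => /udense[i ti].
  exists (x i); first by exists i.
  apply: le_trans (eucl_dist_SW _ _ _ _ (ltW L0) df fL) _.
  by rewrite ler_wpM2l ?sqrtr_ge0// ler_wpM2l// ltW.
have xM p : range x p -> exists2 q, M q & eucl_dist p q <= h.
  move=> [i _ <-]; exists (x i); last by rewrite eucl_distxx ltW.
  by exists (u i); rewrite //= in_itv /= uT.
(* Some curve point is more than [3 * h] away from the subsample; a sample point within [h] of it is
   still more than [2 * h] away. *)
have far (S : {set 'I_n}) : #|S| = b ->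
    2 * h < hausdorff_dist (range x) [set x i | i in [set i | i \in S]].
  move=> Sb; have S0 : S != finset.set0 by rewrite -card_gt0 Sb.
  have hh0 : 0 <= 2 * h by rewrite mulr_ge0// ltW.
  apply/(lt_hausdorff_subsample _ hh0 S0).
  have [|v vI vS] := @far_point _ _ S (fun j => f (u j)) v0 r r0.
    by rewrite Sb.
  have [t tI tv] := rf v vI.
  have [|_ [i _ <-] ti] := near (SW m tau f t).
    by exists t; rewrite //= in_itv.
  exists i => j jS.
  have := vS j jS; rewrite Sb -tv.
  have := dist_le_eucl_dist_SW m tau f t (u j).
  have := eucl_dist_triangle (SW m tau f t) (x i) (x j).
  by rewrite /x in ti *; lra.
have hc : 4 * h <= c.
  suff : 2 * h <= subsample_quantile b x alpha by rewrite /c /critical_value; lra.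
  by apply: subsample_quantile_ge => //; rewrite (subsample_tail_full bn far).
move=> /phi_eq1[[y z] /= Dyz]; rewrite -/c => -[yc cz].
(* From [4 * h <= c]: [2 * e <= c - h] gives [2 * (h + e) <= c + h < 2 * c <= z - y], and
   [2 * e <= c - y] keeps the birth bound [y + e + h] below [2 * c]. *)
pose e := Num.min (c - y) (c - h) / 2.
have e0 : 0 < e by rewrite divr_gt0// lt_min; lra.
have [ey eh] : 2 * e <= c - y /\ 2 * e <= c - h.
  by rewrite /e mulrC divfK ?ge_min ?lexx ?orbT.
have M0 : M !=set0.
  have [|t tI _] := rf v0; first by rewrite lexx lerDl ltW.
  by exists (SW m tau f t), t; rewrite //= in_itv.
have X0 : range x !=set0.
  by have [q /near[p xp _]] := M0; exists p.
have [|||||p [Mp p0 pe]] := @dgm_stability _ F _ (range x) M h e y z _ _ _ _ _ Dyz.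
- by move=> s; exact: sublevel_near.
- by move=> s; exact: sublevel_near.
- exact: ltW.
- by [].
- by lra.
have := hC f reg np => /seteqP[/(_ p) + _]; apply; split => //=.
by rewrite p0 /=; lra.
Qed.

End DenseSample.

(** * Probability of the exceptional events *)

Section RandomSample.
Context {R : realType} {d : measure_display} {Omega : measurableType d}.
Variable P : probability Omega R.
Implicit Types (X : nat -> {RV P >-> R}).

Lemma uniform_prob_itv (a b s t : R) (ab : a < b) : a <= s -> s < t -> t <= b ->
  uniform_prob ab `[s, t] = ((t - s) / (b - a))%:E.
Proof.
move=> as_ st tb.
have sub : `[s, t] `<=` `[a, b].
  by move=> x; rewrite /= !in_itv /= => /andP[sx xt]; lra.
rewrite /uniform_prob integral_uniform_pdf setIidl//.
rewrite (eq_integral (fun=> (b - a)^-1%:E)); last first.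
  by move=> x; rewrite inE => /sub; rewrite /= in_itv /= /uniform_pdf => ->.
rewrite integral_cst//= lebesgue_measure_itv/= lte_fin st -EFinD -EFinM.
by rewrite mulrC.
Qed.

Lemma uniform_prob_cell (a b : R) (ab : a < b) k c : (c < k)%N ->
  uniform_prob ab (cell a b k c) = (k%:R^-1)%:E.
Proof.
move=> ck; have k0 : (0 : R) < k%:R by rewrite ltr0n (leq_ltn_trans _ ck).
have ckR : c.+1%:R <= k%:R :> R by rewrite ler_nat.
rewrite /cell; set w := (b - a) / k%:R.
have w0 : 0 < w by rewrite divr_gt0// subr_gt0.
have wk : w * k%:R = b - a by rewrite /w divfK// gt_eqF.
have c0 : 0 <= c%:R :> R by [].
rewrite -natr1 in ckR *; rewrite uniform_prob_itv.
- congr (_)%:E; rewrite /w; field.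
  by rewrite !gt_eqF// subr_gt0.
- by rewrite lerDl mulr_ge0// ltW.
- by rewrite ltrD2l ltr_pM2r// ltrDl.
- by nra.
Qed.

Lemma measurable_cell (a b : R) k c : measurable (cell a b k c).
Proof. exact: measurable_itv. Qed.

Lemma measurable_cellC (a b : R) k c : measurable (~` cell a b k c).
Proof. by apply: measurableC; exact: measurable_cell. Qed.

Lemma measurable_RV_preimage X i (B : set R) : measurable B ->
  measurable (X i @^-1` B).
Proof. by move=> mB; rewrite -[_ @^-1` _]setTI; exact: measurable_funP. Qed.

Definition missed_cell X (a b : R) (n k : nat) : set Omega :=
  \big[setU/set0]_(c < k) \bigcap_(i in [set i | (i < n)%N])
    (X i @^-1` (~` cell a b k c)).

Lemma measurable_missed_cell X a b n k : measurable (missed_cell X a b n k).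
Proof.
apply: bigsetU_measurable => c _; apply: fin_bigcap_measurable.
  exact: finite_II.
by move=> i _; apply: measurable_RV_preimage; exact: measurable_cellC.
Qed.

(** Union bound over the [k] cells; by independence, [n] times all avoid a given cell with
    probability [(1 - 1/k) ^ n]. *)
Lemma missed_cell_prob X (a b : R) (ab : a < b) n k : iid_uniform ab X ->
  (0 < k)%N ->
  (P (missed_cell X a b n k) <= (k%:R * (1 - k%:R^-1) ^+ n)%:E)%E.
Proof.
move=> [indep unif] k0.
have k0' : (0 : R) < k%:R by rewrite ltr0n.
have Pcell i (c : 'I_k) : P (X i @^-1` (~` cell a b k c)) = (1 - k%:R^-1)%:E.
  have mC : measurable (~` cell a b k c) by exact: measurable_cellC.
  have := unif i _ mC; rewrite /distribution /pushforward => ->.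
  rewrite probability_setC; last exact: measurable_cell.
  rewrite EFinB; congr (1 - _)%E.
  exact: uniform_prob_cell.
pose miss c := \bigcap_(i in [set i | (i < n)%N]) (X i @^-1` (~` cell a b k c)).
have mmiss c : measurable (miss c).
  apply: fin_bigcap_measurable; [exact: finite_II|move=> i _].
  by apply: measurable_RV_preimage; exact: measurable_cellC.
apply: (le_trans (@Boole_inequality _ _ _ P miss k _)) => //.
have -> : k%:R * (1 - k%:R^-1) ^+ n = \sum_(c < k) (1 - k%:R^-1) ^+ n :> R.
  by rewrite sumr_const card_ord mulr_natl.
rewrite -sumEFin; apply: lee_sum => c _; rewrite /miss.
pose J := seq_fset tt (iota 0 n).
have -> : [set i | (i < n)%N] = [set` J].
  by apply/seteqP; split => i /=; rewrite seq_fsetE mem_iota.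
have /= -> := indep J (fun=> ~` cell a b k c) (fun=> @measurable_cellC a b k c).
rewrite (eq_bigr (fun=> (1 - k%:R^-1)%:E)) => [|i _]; last exact: Pcell.
have sJ : #|` J | = n by rewrite size_seq_fset undup_id ?iota_uniq// size_iota.
rewrite prodEFin lee_fin big_const_seq count_predT iter_mulr_1.
by rewrite [size _](_ : _ = n).
Qed.

(** The uniform law confines the times to the interval only almost surely; the exceptions form a
    countable union of null events. *)
Lemma outside_prob0 X (a b : R) (ab : a < b) : iid_uniform ab X ->
  P (\bigcup_i (X i @^-1` (~` `[a, b]))) = 0%E.
Proof.
move=> [_ unif]; have mC : measurable (~` `[a, b] : set R) by exact: measurableC.
apply: measure_negligible.
  by apply: bigcup_measurable => i _; exact: measurable_RV_preimage.
apply: negligible_bigcup => i; apply/negligibleP.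
  exact: measurable_RV_preimage.
transitivity (uniform_prob ab (~` `[a, b])); first exact: unif i _ mC.
rewrite probability_setC//; transitivity (1 - 1%:E : \bar R)%E; last exact: subee.
congr (1 - _)%E; transitivity ((b - a) / (b - a))%:E; last first.
  by rewrite divff// gt_eqF// subr_gt0.
exact: uniform_prob_itv.
Qed.

(* Outer measures need not be continuous from above, so the almost sure bound on
   [c_alpha] is turned into a bound in probability through these events.  The
   clause [0 < b] spares the junk distance to the empty subsample. *)
Definition large_quantile X m tau f n b (alpha s : R) : set Omega :=
  [set w | (0 < b)%N /\
    alpha < subsample_tail b (SW_sample m tau f X n w) s].

(** For nonempty subsamples, exceeding [s] is a finite union of finite intersections of conditions
    on pairwise distances, which are continuous functions of the sampling times. *)
Lemma measurable_large_quantile X m tau (f : R -> R) n b (alpha s : R) :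
  continuous f -> 0 <= s -> measurable (large_quantile X m tau f n b alpha s).
Proof.
move=> cf s0; rewrite /large_quantile.
case: b => [|b]; first by rewrite (_ : mkset _ = set0)//; apply/seteqP; split => w [].
pose x := SW_sample m tau f X n.
have mx i j : measurable_fun setT (fun w => eucl_dist (x w i) (x w j)).
  apply: measurableT_comp.
    by apply: continuous_measurable_fun; exact: sqrt_continuous.
  apply: measurable_sum => k; apply: measurable_funX; apply: measurable_funB.
    rewrite (_ : (fun w => _) = f \o (fun w => X i w + k%:R * tau)); last first.
      by apply/funext => w; rewrite /x /SW_sample /SW mxE.
    apply: measurableT_comp; first exact: continuous_measurable_fun.
    by apply: measurable_funD => //; exact: measurable_cst.
  rewrite (_ : (fun w => _) = f \o (fun w => X j w + k%:R * tau)); last first.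
    by apply/funext => w; rewrite /x /SW_sample /SW mxE.
  apply: measurableT_comp; first exact: continuous_measurable_fun.
  by apply: measurable_funD => //; exact: measurable_cst.
pose A (S : {set 'I_n}) := [set w | s <
  hausdorff_dist (range (x w)) [set x w i | i in [set i | i \in S]]].
have mA (S : {set 'I_n}) : #|S| == b.+1 -> measurable (A S).
  move=> /eqP Sb; have S0 : S != finset.set0 by rewrite -card_gt0 Sb.
  have -> : A S = \bigcup_(i in [set: 'I_n]) \bigcap_(j in [set j | j \in S])
      [set w | s < eucl_dist (x w i) (x w j)].
    apply/seteqP; split => w.
      by move=> /(lt_hausdorff_subsample _ s0 S0)[i iS]; exists i.
    move=> [i _ iS]; apply/(lt_hausdorff_subsample _ s0 S0).
    by exists i => j /iS.
  apply: fin_bigcup_measurable; first exact: finite_finset.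
  move=> i _; apply: fin_bigcap_measurable; first exact: finite_finset.
  move=> j _; rewrite -[X in measurable X]setTI.
  have -> : [set w | s < eucl_dist (x w i) (x w j)] =
      (fun w => eucl_dist (x w i) (x w j)) @^-1` `]s, +oo[.
    by apply/seteqP; split => w /=; rewrite in_itv /= andbT.
  exact: mx.
have mtail : measurable_fun setT (fun w => subsample_tail b.+1 (x w) s).
  have -> : (fun w => subsample_tail b.+1 (x w) s) = (fun w =>
      ('C(n, b.+1)%:R)^-1 * \sum_(S : {set 'I_n})
        (if #|S| == b.+1 then \1_(A S) w else 0)).
    apply/funext => w; rewrite /subsample_tail big_mkcond; congr (_ * _).
    apply: eq_bigr => S _; case: ifP => // _; rewrite indicE.
    by congr (nat_of_bool _)%:R; apply/idP/idP; rewrite inE.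
  apply: measurable_funM; first exact: measurable_cst.
  apply: measurable_sum => S.
  case: (boolP (#|S| == b.+1)) => Sb; last exact: measurable_cst.
  by apply: measurable_indic; exact: mA.
rewrite (_ : mkset _ = (fun w => subsample_tail b.+1 (x w) s) @^-1` `]alpha, +oo[).
  by rewrite -[X in measurable X]setTI; exact: mtail.
by apply/seteqP; split => w /=; rewrite in_itv /= andbT => // -[].
Qed.

End RandomSample.

(** * Asymptotics and the significance level *)

(** With [k = A * b n], the growth of [b] gives [k * ln n <= n / 2], so the power is at most
    [exp(- n / k) <= n ^ -2]; the factor [k <= n] leaves [1 / n]. *)
Lemma missed_cells_vanish (R : realType) (A : nat) (b : nat -> nat) (e : R) :
  (0 < A)%N -> 0 < e -> b n @[n --> \oo] --> \oo ->
  (fun n => (b n)%:R : R^o) =o_\oo (fun n => n%:R / ln n%:R : R^o) ->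
  \forall n \near \oo, (0 < b n <= n)%N /\
    (A * b n)%:R * (1 - (A * b n)%:R^-1) ^+ n <= e.
Proof.
move=> A0 e0 hb /eqoP hbo.
have A0' : (0 : R) < A%:R by rewrite ltr0n.
have e' : 0 < (2 * A%:R)^-1 :> R by rewrite invr_gt0 mulr_gt0.
near=> n.
have b0 : (0 < b n)%N by near: n; exact: (hb _ (nbhs_infty_gt 0)).
have n1 : expR 1 <= n%:R :> R by near: n; exact: nbhs_infty_ger.
have ne : e^-1 <= n%:R by near: n; exact: nbhs_infty_ger.
have n0 : (0 : R) < n%:R by apply: lt_le_trans n1; exact: expR_gt0.
have ln1 : 1 <= ln n%:R :> R by rewrite -[leLHS]expRK ler_ln// posrE// expR_gt0.
have : `|(b n)%:R : R^o| <= (2 * A%:R)^-1 * `|n%:R / ln n%:R : R^o|.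
  by near: n; exact: hbo.
rewrite /= !ger0_norm//; last by rewrite divr_ge0// (le_trans ler01).
set k := (A * b n)%N.
have k0 : (0 : R) < k%:R by rewrite ltr0n muln_gt0 A0.
move=> bn.
have kln : k%:R * ln n%:R <= n%:R / 2 :> R.
  have := ler_wpM2l (ltW A0') bn; rewrite -[A%:R * (b n)%:R]natrM -/k.
  have -> : A%:R * ((2 * A%:R)^-1 * (n%:R / ln n%:R)) = n%:R / 2 / ln n%:R :> R.
    by field; rewrite !gt_eqF// (lt_le_trans ltr01).
  by rewrite ler_pdivlMr// (lt_le_trans ltr01).
have kn : k%:R <= n%:R :> R by nra.
split.
  rewrite b0 /= -(@ler_nat R); apply: le_trans kn.
  by rewrite ler_nat leq_pmull.
have pow : (1 - k%:R^-1) ^+ n <= (n%:R ^+ 2)^-1 :> R.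
  apply: (@le_trans _ _ (expR (- k%:R^-1) ^+ n)).
    apply: lerXn2r; rewrite ?nnegrE ?expR_ge0//; last exact: expR_ge1Dx.
    by rewrite subr_ge0 invf_le1// ler1n -(ltr0n R).
  rewrite -expRM_natl -[leRHS]lnK ?posrE ?invr_gt0 ?exprn_gt0//.
  rewrite ler_expR lnV ?posrE ?exprn_gt0// lnXn// mulrN lerN2 mulr2n.
  by rewrite ler_pdivlMr//; lra.
apply: (@le_trans _ _ (n%:R * (n%:R ^+ 2)^-1)).
  apply: ler_pM => //.
  by rewrite exprn_ge0// subr_ge0 invf_le1// ler1n -(ltr0n R).
have -> : n%:R * (n%:R ^+ 2)^-1 = n%:R^-1 :> R by field; rewrite gt_eqF.
by rewrite invf_ple ?posrE.
Unshelve. all: by end_near. Qed.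

Theorem theorem6p1 (R : realType) (F : fieldType)
  (d : measure_display) (Omega : measurableType d) (P : probability Omega R)
  (Tmin Tmax : R) (hT : Tmin < Tmax)
  (X : nat -> {RV P >-> R}) (hX : iid_uniform hT X)
  (m : nat) (tau : R) (htau : 0 < tau)
  (delta L K eps : R) (hdelta : 0 < delta) (hL : 0 < L) (hK : 0 < K)
  (heps : 0 < eps)
  (C : R -> R -> R)
  (hC : birth_constant F delta L K eps Tmin Tmax m tau (C delta L))
  (alpha : R) (halpha : 0 < alpha < 1)
  (f : R -> R) (hreg : regular delta L K eps f) (H0 : nonperiodic eps K f)
  (b : nat -> nat) (hb : b n @[n --> \oo] --> \oo)
  (hbo : (fun n => (b n)%:R : R^o) =o_\oo (fun n => n%:R / ln n%:R : R^o))
  (ha : {ae P, forall w, \forall n \near \oo,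
     4 * critical_value (b n) alpha (SW_sample m tau f X n w)
       <= birth_bound m eps (C delta L)}) :
  (limn_esup (fun n =>
     mu_ext P [set w | phi F (b n) alpha (SW_sample m tau f X n w) = 1%N])
   <= alpha%:E)%E.
Proof.
have /andP[a0 a1] := halpha.
have df t : derivable f t 1 by case: hreg => -[].
have cf : continuous f.
  by move=> z; exact/differentiable_continuous/derivable1_diffP.
set B := birth_bound m eps (C delta L) in ha.
have B0 : 0 < B.
  by rewrite /B /birth_bound mulr_gt0 ?divr_gt0 ?sqrtr_gt0// lt_min heps hC.1.
have [s [t [sI tI fst]]] := regular_nonconstant hdelta hK heps hT hreg.
have onto v : f s <= v <= f s + (f t - f s) ->
    exists2 t, Tmin <= t <= Tmax & f t = v.
  rewrite addrC subrK => vI.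
  have cw a c : {within `[a, c], continuous f} by exact: continuous_subspaceT.
  have [st|ts] := leP s t.
    have [|z zI <-] := IVT st (cw s t) (v := v).
      by rewrite ge_min le_max; case/andP: vI => -> ->; rewrite orbT.
    by exists z => //; move: zI; rewrite in_itv /=; lra.
  have [|z zI <-] := IVT (ltW ts) (cw t s) (v := v).
    by rewrite ge_min le_max; case/andP: vI => -> ->; rewrite orbT.
  by exists z => //; move: zI; rewrite in_itv /=; lra.
set r := f t - f s in onto; have r0 : 0 < r by rewrite subr_gt0.
(* Chosen so that [A > Q] yields [3 * h < r / (2 * b n)] when there are [A * b n] cells. *)
set Q := 6 * Num.sqrt m.+1%:R * L * (Tmax - Tmin) / r.
have [A [A0 QA]] : exists A : nat, (0 < A)%N /\ Q < A%:R.
  exists (Num.truncn Q).+1; split => //; exact: truncnS_gt.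
(* The threshold lies strictly between [B / 8], the eventual bound that [ha] puts on the quantile,
   and [B / 4], below which twice the critical value is less than [B]. *)
pose D n := large_quantile X m tau f n (b n) alpha (B / 6).
have mD n : measurable (D n).
  by apply: measurable_large_quantile => //; rewrite divr_ge0// ltW.
have DP : P (lim_sup_set D) = 0%:E.
  apply: measure_negligible.
    by apply: bigcap_measurable => // k _; exact: bigcup_measurable.
  apply: negligibleS ha => w Dw /= [N _ HN].
  have [n /= Nn [_ Dn]] := Dw N Logic.I.
  have := subsample_quantile_ge (ltW a0) Dn; have := HN n Nn.
  by rewrite /critical_value; lra.
have Pfin : (P (\bigcup_(k >= 0) D k) < +oo)%E.
  by rewrite ltey_eq fin_num_measure//; exact: bigcup_measurable.
have mtail n : measurable (\bigcup_(k >= n) D k) by exact: bigcup_measurable.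
have Dsmall : \forall n \near \oo,
    (P (\bigcup_(k >= n) D k) <= (alpha / 2)%:E)%E.
  (* Continuity from above along the decreasing tail unions of [D]. *)
  have /fine_cvgP[_] : P (\bigcup_(k >= n) D k) @[n --> \oo] --> 0%:E.
    by rewrite -DP; exact: lim_sup_set_cvg.
  move=> /cvgr_le/(_ (alpha / 2)) /=; rewrite divr_gt0// => /(_ isT).
  by apply: filterS => n; rewrite -lee_fin fineK// fin_num_measure.
have cells := missed_cells_vanish A0 (divr_gt0 a0 (ltr0Sn R 1)) hb hbo.
have [N _ HN] : \forall n \near \oo,
    (mu_ext P [set w | phi F (b n) alpha (SW_sample m tau f X n w) = 1%N]
      <= alpha%:E)%E.
  apply: filterS2 Dsmall cells => n Dn [/andP[bn0 bn] cells_n].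
  set k := (A * b n)%N in cells_n; have k0 : (0 < k)%N by rewrite muln_gt0 A0.
  set miss := missed_cell X Tmin Tmax n k.
  set out := \bigcup_i (X i @^-1` (~` `[Tmin, Tmax])).
  have mmiss : measurable miss by exact: measurable_missed_cell.
  have mout : measurable out.
    apply: bigcup_measurable => i _; apply: measurable_RV_preimage.
    exact: measurableC.
  have mbad : measurable (miss `|` out `|` \bigcup_(j >= n) D j).
    by apply: measurableU => //; exact: measurableU.
  have Pbad : (P (miss `|` out `|` \bigcup_(j >= n) D j) <= alpha%:E)%E.
    apply: le_trans (measureU2 _ _ _) _ => //; first exact: measurableU.
    have -> : alpha = alpha / 2 + alpha / 2 by rewrite -splitr.
    rewrite EFinD; apply: leeD => //.
    apply: le_trans (measureU2 _ _ _) _ => //.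
    have out0 : (P out <= 0)%E by rewrite (outside_prob0 hX).
    rewrite -[leRHS]adde0; apply: leeD; last exact: out0.
    by apply: le_trans (missed_cell_prob n hX k0) _; rewrite lee_fin.
  (* The rejection event is bounded in outer measure by a measurable event containing it: a missed
     cell, a time outside the interval, or a large quantile from [n] on. *)
  apply: le_trans Pbad; rewrite -measurable_mu_extE//; apply: le_mu_ext.
  move=> w /= phi1; apply: contrapT => good.
  have uT i : Tmin <= X i w <= Tmax.
    by apply/negP => iT; apply: good; left; right; exists i.
  have dense t' : Tmin <= t' <= Tmax ->
      exists i : 'I_n, `|t' - X i w| <= (Tmax - Tmin) / k%:R.
    move=> /(mem_cell k0)[c ct]; apply: contrapT => far.
    apply: good; left; left; rewrite /miss /missed_cell.
    rewrite -(bigcup_mkord k (fun c => \bigcap_(i in [set i | (i < n)%N])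
      (X i @^-1` (~` cell Tmin Tmax k c)))).
    exists (c : nat) => /=; first exact: ltn_ord.
    move=> i /= ni ci; apply: far; exists (Ordinal ni).
    exact: cell_diam ct ci.
  have small : 2 * critical_value (b n) alpha (SW_sample m tau f X n w) < B.
    have : subsample_quantile (b n) (SW_sample m tau f X n w) alpha <= B / 6.
      apply: subsample_quantile_le; first by rewrite divr_ge0// ltW.
      rewrite leNgt; apply/negP => tailD; apply: good; right.
      by exists n => //=.
    by rewrite /critical_value; lra.
  have bR : (0 : R) < (b n)%:R by rewrite ltr0n.
  have AR : (0 : R) < A%:R by rewrite ltr0n.
  apply: (dense_sample_accepts hL hC _ hreg H0 r0 onto _ _ _
    (fun i : 'I_n => uT i) dense small) phi1.
  - by rewrite (ltW a0).
  - by rewrite divr_gt0 ?subr_gt0// ltr0n.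
  - by rewrite bn0.
  - have -> : 3 * (Num.sqrt m.+1%:R * (L * ((Tmax - Tmin) / k%:R))) =
        Q / A%:R * (r / (2 * (b n)%:R)).
      by rewrite /Q /k natrM; field; rewrite !gt_eqF.
    by rewrite gtr_pMl ?divr_gt0 ?mulr_gt0// ltr_pdivrMr// mul1r.
apply: le_trans (ereal_inf_lbound _) _.
  by exists [set n | (N <= n)%N] => //; exists N.
by apply: ge_ereal_sup => _ [n Nn <-]; exact: HN.
Qed.
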